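(* For every natural number $k>1$ and every $d\ge 4$, $$\frac{|G^A_{k+1,d}|}{|G^A_{k,d}|}=\frac{|G^A_{k+1,d}|}{|G^A_{2,d}|}=\frac{|G^A_{k,d}|}{|G^A_{1,d}|}=\infty ,$$ where for $k,r\ge 1$ the relative dimension is $\frac{|G^A_{k,d}|}{|G^A_{r,d}|}:=\lim_{n\to\infty}\frac{|P^nG^A_{k,d}|}{|P^nG^A_{r,d}|}$; that is, each of the three corresponding limits equals $+\infty$.
   Context: Colors are the three Mallet-Yorke indices $1$ (blue), $-1$ (red), $0$ (green). For integers $k\ge1$, $d\ge4$, $G_{k,d}$ is the collection of colored graphs (bifurcation diagrams: edges are branches of periodic orbits colored by their index, vertices are bifurcations) in which every vertex has degree at most $k+2$, the index is invariant at each bifurcation, and each bifurcation obeys the admissible rules for dimension $d$. $G^A_{k,d}$ is the collection of trees (connected acyclic graphs) in $G_{k,d}$. The star representation interchanges edges and vertices: every edge of a diagram becomes a colored vertex, and a bifurcation in which an orbit with index $i$ splits into orbits with indices $i_1,\dots,i_c$ (written $i\to(i_1,\dots,i_c)$) becomes a star whose center is colored $i$ and whose leaves are colored $i_1,\dots,i_c$; stars are glued at corresponding vertices. A saddle-node bifurcation becomes a single edge joining the two colors of the colliding orbits. The degree of a tree is the highest number of children any node has; an $m$-ary tree is one in which each node has no more than $m$ children. Trees are rooted, and $m$-ary trees with $n$ vertices are counted in the usual way in which their number is $\frac{1}{(m-1)n+1}\binom{mn}{n}$, i.e. each node has $m$ distinguishable child positions, each of which is empty or occupied. $P^nG^A_{k,d}$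 is the set of all connected acyclic diagrams of degree $k+1$ on $n$ vertices in the star representation of $G^A_{k,d}$. Explicitly, it is the set of $(k+1)$-ary trees on $n$ vertices with vertices colored by $\{1,-1,0\}$ such that for every vertex of color $i$ with $c\ge1$ children, the multiset of colors of its children is one of the following (the order of the children's colors is arbitrary): (i) $c=1$ (saddle-node): the vertex and its child have colors $\{1,-1\}$, or both have color $0$. (ii) $c=2$ (period-doubling): $1\to(0,1)$, $0\to(-1,1)$, or $-1\to(-1,0)$. (iii) $c=3$ (type $m\ge3$): $1\to(1,-1,1)$, $-1\to(-1,1,-1)$, $0\to(0,0,0)$, or $0\to(0,-1,1)$. (iv) $c=n'$ with $4\le n'\le k+1$ ($n'$-junction): color $\pm1$ splits into $n'-1$ vertices of color $0$ and one of color $\pm1$; or color $\pm1$ splits into $2j$ vertices of color $-1$ and $j$ of color $1$, or the opposite, where $n'=3j$; or color $0$ splits into $n'$ vertices all of color $0$. In (ii)-(iv) the index invariance $i=\sum_{l=1}^{c} i_l$ is always required in addition. *)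

(* Defs.v *)
From HB Require Import structures.
From mathcomp Require Import all_boot all_order all_algebra.
From mathcomp Require Import all_classical all_reals all_analysis.

Set Implicit Arguments.
Unset Strict Implicit.
Unset Printing Implicit Defensive.

Import Order.TTheory GRing.Theory Num.Theory.

Local Open Scope ring_scope.

(* The three Mallet-Yorke indices. *)
Inductive color := Blue | Red | Green.

Definition index_of (c : color) : int :=
  match c with Blue => 1 | Red => -1 | Green => 0 end.

Definition color_code (c : color) : option bool :=
  match c with Blue => Some true | Red => Some false | Green => None end.
Definition color_decode (o : option bool) : color :=
  match o with Some true => Blue | Some false => Red | None => Green end.
Lemma color_codeK : cancel color_code color_decode.
Proof. by case. Qed.

HB.instance Definition _ := Finite.copy color (can_type color_codeK).

(* Bifurcation rules.  [i] is the color of a vertex and [s] lists the colors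
   of its children; [perm_eq] makes the rules depend only on the multiset [s]. *)
Definition index_invariant (i : color) (s : seq color) : bool :=
  index_of i == \sum_(c <- s) index_of c.

Definition saddle_node (i : color) (s : seq color) : bool :=
  perm_eq (i :: s) [:: Blue; Red] || (i :: s == [:: Green; Green]).

Definition period_doubling (i : color) (s : seq color) : bool :=
  match i with
  | Blue => perm_eq s [:: Green; Blue]
  | Green => perm_eq s [:: Red; Blue]
  | Red => perm_eq s [:: Red; Green]
  end.

Definition type_ge3 (i : color) (s : seq color) : bool :=
  match i with
  | Blue => perm_eq s [:: Blue; Red; Blue]
  | Red => perm_eq s [:: Red; Blue; Red]
  | Green => perm_eq s [:: Green; Green; Green]
             || perm_eq s [:: Green; Red; Blue]
  end.

(* The signs in "+1 or -1" are left independent here: they are tied together by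
   [index_invariant] in [admissible].  In the second rule, [perm_eq] forces
   [size s = 3 * j]. *)
Definition junction (k : nat) (i : color) (s : seq color) : bool :=
  let n' := size s in
  let j := (n' %/ 3)%N in
  (4 <= n' <= k.+1)%N &&
  if i == Green then s == nseq n' Green
  else [|| perm_eq s (Blue :: nseq n'.-1 Green),
           perm_eq s (Red :: nseq n'.-1 Green),
           perm_eq s (nseq (2 * j) Red ++ nseq j Blue)
         | perm_eq s (nseq (2 * j) Blue ++ nseq j Red)].

(* Index invariance is not required at a saddle-node. *)
Definition admissible (k : nat) (i : color) (s : seq color) : bool :=
  saddle_node i s
  || index_invariant i s
     && [|| period_doubling i s, type_ge3 i s | junction k i s].

(* Colored m-ary trees of height at most [h] (height counted in vertices):
   [None] is the empty tree, i.e. an unoccupied child position, and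
   [Some (c, f)] is a root of color [c] with the [m] distinguishable child
   positions filled according to [f]. *)
Fixpoint tree (m h : nat) : finType :=
  match h with
  | 0 => unit
  | h'.+1 => option (color * {ffun 'I_m -> tree m h'})
  end.

Definition root_color (m h : nat) : tree m h -> option color :=
  match h return tree m h -> option color with
  | 0 => fun=> None
  | h'.+1 => fun t : option (color * {ffun 'I_m -> tree m h'}) => omap fst t
  end.

Definition child_colors (m h : nat) (f : {ffun 'I_m -> tree m h}) :
    seq color :=
  pmap (fun p : 'I_m => root_color (f p)) (enum 'I_m).

Fixpoint nvertices (m h : nat) : tree m h -> nat :=
  match h return tree m h -> nat with
  | 0 => fun=> 0%N
  | h'.+1 => fun t : option (color * {ffun 'I_m -> tree m h'}) =>
      if t is Some (_, f) then (\sum_(p < m) nvertices (f p)).+1 else 0%N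
  end.

Fixpoint admissible_tree (k m h : nat) : tree m h -> bool :=
  match h return tree m h -> bool with
  | 0 => fun=> true
  | h'.+1 => fun t : option (color * {ffun 'I_m -> tree m h'}) =>
      if t is Some (c, f) then
        (nilp (child_colors f) || admissible k c (child_colors f))
        && [forall p, admissible_tree k (f p)]
      else true
  end.

(* P^n G^A_{k,d}.  A tree with [n] vertices has height at most [n], so
   [tree k.+1 n] contains every (k+1)-ary tree on [n] vertices.  For d >= 4 the
   admissible rules are the same in every dimension, hence [d] does not occur
   in the body. *)
Definition PnGA (k d n : nat) : {set tree k.+1 n} :=
  [set t : tree k.+1 n | (nvertices t == n) && admissible_tree k t].

(* The sequence whose limit is the relative dimension |G^A_{k,d}|/|G^A_{r,d}|. *)
Definition PnGA_ratio (R : realType) (d k r : nat) : R^nat :=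
  fun n => #|PnGA k d n|%:R / #|PnGA r d n|%:R.

(* Main.v *)
(** Write [m = k + 1], so that the trees are [m]-ary. Raising [k] adds a child
    position, and at each vertex with [c >= 1] children the number of ways of
    placing them grows by the factor [C(m+1, c) / C(m, c) >= 1 + 1/m]. A tree on
    [n] vertices has at least [(n-1)/m] such vertices, so the number of trees
    grows by a factor of at least [(1 + 1/m)^((n-1)/m) >= 1 + (n-1)/m^2].

    The count is a double counting with a nonnegative kernel between [m]-ary and
    [(m+1)-ary] trees supported on pairs that differ only in the positions of the
    children: its row sums are at least [1 + (n-1)/m^2], its column sums are at
    most [1]. *)

Require Import Defs.
From mathcomp Require Import all_boot all_order all_algebra.
From mathcomp Require Import all_classical all_reals all_analysis.
From mathcomp Require Import ring lra zify.

Import Order.TTheory GRing.Theory Num.Theory.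
Import numFieldNormedType.Exports.

Local Open Scope classical_set_scope.
Local Open Scope ring_scope.

(** * Child positions, rules, and the kernel between trees *)

(** Both lists are strictly increasing with the same elements. Hence inserting an empty position [j]
    leaves the list of child colors unchanged. *)
Lemma filter_neq_enum_ord (m : nat) (j : 'I_m.+1) :
  [seq i <- enum 'I_m.+1 | i != j] = [seq lift j p | p <- enum 'I_m].
Proof.
apply: (inj_map val_inj).
apply: (irr_sorted_eq ltn_trans ltnn).
- apply: (subseq_sorted ltn_trans (s2 := iota 0 m.+1)); last exact: iota_ltn_sorted.
  by rewrite -val_enum_ord; exact/map_subseq/filter_subseq.
- rewrite -map_comp (eq_map (g := bump j \o val))// map_comp val_enum_ord.
  rewrite sorted_map; apply: sub_sorted (iota_ltn_sorted 0 m) => x y /=.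
  by rewrite /bump; lia.
- move=> x; apply/mapP/mapP => -[i].
    rewrite mem_filter => /andP[ij _] ->; exists i => //.
    case: (unliftP j i) ij => [p -> _|->]; last by rewrite eqxx.
    by rewrite map_f// mem_enum.
  move=> /mapP[p _ ->] ->; exists (lift j p) => //.
  by rewrite mem_filter mem_enum eq_sym neq_lift.
Qed.

(** [k] enters the rules only through the upper bound on the size of a junction. *)
Lemma admissibleS (k : nat) (i : color) (s : seq color) :
  admissible k i s -> admissible k.+1 i s.
Proof.
rewrite /admissible => /orP[->//|/andP[-> /or3P[->|->|]]]; rewrite ?orbT//.
by rewrite /junction => /andP[/andP[-> /leqW ->]] ->; rewrite !orbT.
Qed.

Definition empty (m h : nat) : tree m h :=
  if h is h'.+1 return tree m h then None else tt.

Lemma root_color_empty (m h : nat) (t : tree m h) :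
  (root_color t == None) = (t == empty m h).
Proof. by case: h t => [|h] /= [] // []. Qed.

Lemma nvertices_eq0 (m h : nat) (t : tree m h) :
  (nvertices t == 0%N) = (t == empty m h).
Proof. by case: h t => [|h] /= [] // []. Qed.

Lemma sum_tree (R : nmodType) (m h : nat) (F : tree m h.+1 -> R) :
  \sum_t F t = F None + \sum_c \sum_(f : {ffun 'I_m -> tree m h}) F (Some (c, f)).
Proof.
rewrite (bigD1 None)//=; congr (_ + _).
rewrite pair_bigA/=.
rewrite (reindex_omap (I := option _) (J := (color * {ffun 'I_m -> tree m h})%type) Some id)//=.
  by apply: eq_big => [[c f]|[c f] _]/=; rewrite ?eqxx.
by case.
Qed.

(* [u] is obtained from [t] by inserting, at every vertex, an empty position
   [j]; the weight is shared evenly among the empty positions of [u], which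
   makes the column sums at most [1]. *)
Fixpoint transport (R : realFieldType) (m h : nat) : tree m h -> tree m.+1 h -> R :=
  match h return tree m h -> tree m.+1 h -> R with
  | 0 => fun _ _ => 1
  | h'.+1 => fun (t : option (color * {ffun 'I_m -> tree m h'}))
                 (u : option (color * {ffun 'I_m.+1 -> tree m.+1 h'})) =>
      match t, u with
      | Some (c, f), Some (c', g) =>
          (c' == c)%:R *
          ((\sum_(j | g j == empty m.+1 h')
              \prod_p transport R m h' (f p) (g (lift j p)))
           / #|[pred j | g j == empty m.+1 h']|%:R)
      | None, None => 1
      | _, _ => 0
      end
  end.
Arguments transport R {m h}.

Lemma transport_ge0 (R : realFieldType) (m h : nat) (t : tree m h) (u : tree m.+1 h) :
  0 <= transport R t u.
Proof.
elim: h t u => [|h IH] /=; first by move=> *; exact: ler01.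
move=> [[c f]|] [[c' g]|] //.
by rewrite mulr_ge0// divr_ge0// sumr_ge0// => j _; exact: prodr_ge0.
Qed.

(** A nonzero weight yields an empty position [j] of [g] at which every factor is nonzero; induction
    then applies to each pair [f p], [g (lift j p)]. *)
Lemma transportP (R : realFieldType) (k m h : nat) (t : tree m h) (u : tree m.+1 h) :
  transport R t u != 0 ->
  [/\ root_color u = root_color t, nvertices u = nvertices t
    & admissible_tree k t -> admissible_tree k.+1 u].
Proof.
elim: h t u => [|h IH] //= [[c f]|] [[c' g]|] //=; rewrite ?eqxx//.
rewrite mulf_eq0 negb_or => /andP[].
rewrite pnatr_eq0 eqb0 negbK => /eqP -> {c'}.
rewrite mulf_eq0 negb_or => /andP[+ _].
rewrite psumr_neq0; last by move=> j _; apply: prodr_ge0 => p _; exact: transport_ge0.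
move=> /hasP[j _ /andP[/eqP gj]]; rewrite lt0r => /andP[/prodf_neq0 Kfg _].
have fg p := IH _ _ (Kfg p isT).
have gj0 : root_color (g j) = None by apply/eqP; rewrite root_color_empty gj.
have cc : child_colors g = child_colors f.
  rewrite /child_colors.
  have -> : pmap (fun p => root_color (g p)) (enum 'I_m.+1)
          = pmap (fun p => root_color (g p)) [seq i <- enum 'I_m.+1 | i != j].
    elim: (enum 'I_m.+1) => //= i s ->.
    by case: eqP => [->|_]//=; rewrite gj0.
  rewrite filter_neq_enum_ord.
  elim: (enum 'I_m) => //= p s ->.
  by have [-> _ _] := fg p.
split=> //.
  rewrite (bigD1_ord j)//= gj; congr _.+1.
  have /eqP -> : nvertices (empty m.+1 h) == 0%N by rewrite nvertices_eq0.
  by rewrite add0n; apply: eq_bigr => p _; have [] := fg p.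
move=> /andP[af /forallP at_]; apply/andP; split.
  by rewrite cc; case/orP: af => [->//|/admissibleS ->]; rewrite orbT.
apply/forallP => i; case: (unliftP j i) => [p ->|->].
  by have [_ _] := fg p; exact.
by rewrite gj; case: (h).
Qed.

(** * Row and column sums of the kernel *)

Definition branching (R : realFieldType) (m h : nat)
    (f : {ffun 'I_m -> tree m h}) (g : {ffun 'I_m.+1 -> tree m.+1 h}) : R :=
  (\sum_(j | g j == empty m.+1 h) \prod_p transport R (f p) (g (lift j p)))
  / #|[pred j | g j == empty m.+1 h]|%:R.

Lemma sum_transport_row (R : realFieldType) (m h : nat) c (f : {ffun 'I_m -> tree m h}) :
  \sum_(u : tree m.+1 h.+1) transport R (Some (c, f) : tree m h.+1) u
  = \sum_g branching R m h f g.
Proof.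
rewrite sum_tree /= add0r (bigD1 c)//= eqxx [X in _ + X]big1 ?addr0.
  by apply: eq_bigr => g _; rewrite mul1r.
by move=> c' /negPf cc'; rewrite big1// => g _; rewrite cc' mul0r.
Qed.

Lemma sum_transport_col (R : realFieldType) (m h : nat) c (g : {ffun 'I_m.+1 -> tree m.+1 h}) :
  \sum_(t : tree m h.+1) transport R t (Some (c, g) : tree m.+1 h.+1)
  = \sum_f branching R m h f g.
Proof.
rewrite sum_tree /= add0r (bigD1 c)//= eqxx [X in _ + X]big1 ?addr0.
  by apply: eq_bigr => f _; rewrite mul1r.
by move=> c' /negPf cc'; rewrite big1// => f _; rewrite eq_sym cc' mul0r.
Qed.

(** For each empty [j], the sum over [f] factors into column sums of subtrees, each at most [1]; the
    weight averages these products over [j]. *)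
Lemma transport_col_le1 (R : realFieldType) (m h : nat) (u : tree m.+1 h) :
  \sum_(t : tree m h) transport R t u <= 1.
Proof.
elim: h u => [|h IH] u.
  by rewrite (bigD1 (tt : tree m 0))//= big1 ?addr0// => -[].
case: u => [[c g]|]; last first.
  rewrite sum_tree/= big1 ?addr0// => c _.
  by rewrite big1.
rewrite sum_transport_col /branching -mulr_suml exchange_big/=.
(* If [g] has no empty position, the convention that [0] has inverse [0] makes the column sum
   vanish. *)
have [->|e0] := eqVneq #|[pred j | g j == empty m.+1 h]| 0%N.
  by rewrite invr0 mulr0.
rewrite ler_pdivrMr ?ltr0n ?lt0n// mul1r.
rewrite -sum1_card natr_sum; apply: ler_sum => j _.
rewrite -(bigA_distr_bigA (fun p t => transport R t (g (lift j p)))).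
apply: prodr_ile1 => p _; rewrite IH andbT.
by apply: sumr_ge0 => t _; exact: transport_ge0.
Qed.

Lemma prodr_ge_1Dsum (R : realFieldType) (I : finType) (x : I -> R) :
  (forall i, 0 <= x i) -> 1 + \sum_i x i <= \prod_i (1 + x i).
Proof.
move=> x0.
(* Carrying nonnegativity of the sum through the induction keeps the partial product at least
   [1]. *)
suff /andP[] : 0 <= \sum_i x i <= \prod_i (1 + x i) - 1 by rewrite lerBrDl.
elim/big_rec2 : _ => [|i y z _ /andP[z0 zy]]; first by rewrite subrr lexx.
have xi := x0 i; apply/andP; split; nra.
Qed.

(** There are [m.+1] choices of [j], while [g] has at most [m] empty positions as soon as one child
    is present. So every non-leaf gains a factor [1 + 1/m]. *)
Lemma sum_branching_ge (R : realFieldType) (m h : nat) (f : {ffun 'I_m -> tree m h})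
    (N := (\sum_p nvertices (f p))%N) :
  (0 < m)%N ->
  m.+1%:R / (if N == 0%N then m.+1 else m)%:R
    * \prod_p \sum_u transport R (f p) u <= \sum_g branching R m h f g.
Proof.
move=> m0; set a := (if _ then _ else _).
have a0 : (0 < a)%N by rewrite /a; case: ifP.
(* Absorbing the condition [g j = empty] as a factor turns the sum over [g]
   into a product of sums over the positions. *)
pose T j (i : 'I_m.+1) (u : tree m.+1 h) : R :=
  if unlift j i is Some p then transport R (f p) u else (u == empty m.+1 h)%:R.
have TE j (g : {ffun 'I_m.+1 -> tree m.+1 h}) : \prod_i T j i (g i) =
    (g j == empty m.+1 h)%:R * \prod_p transport R (f p) (g (lift j p)).
  rewrite (bigD1_ord j)//= /T unlift_none; congr (_ * _).
  by apply: eq_bigr => p _; rewrite liftK.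
have TS j : \sum_(g : {ffun 'I_m.+1 -> tree m.+1 h}) \prod_i T j i (g i) =
    \prod_p \sum_u transport R (f p) u.
  rewrite -(bigA_distr_bigA (T j)) (bigD1_ord j)//= /T unlift_none.
  rewrite (bigD1 (empty m.+1 h))//= eqxx [X in (_ + X) * _]big1.
    by rewrite addr0 mul1r; apply: eq_bigr => p _; rewrite liftK.
  by move=> u /negPf ->.
have -> : m.+1%:R / a%:R * \prod_p \sum_u transport R (f p) u =
    \sum_(g : {ffun 'I_m.+1 -> tree m.+1 h}) \sum_j \prod_i T j i (g i) / a%:R.
  rewrite exchange_big/=.
  under [RHS]eq_bigr do rewrite -mulr_suml TS.
  by rewrite sumr_const card_ord -[RHS]mulr_natl mulrA mulrAC.
apply: ler_sum => g _; rewrite /branching mulr_suml [leRHS]big_mkcond/=.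
apply: ler_sum => j _; rewrite TE.
have [gj|_] := ifPn; last by rewrite !mul0r.
rewrite mul1r.
(* Where the product is nonzero, [transportP] makes [g (lift j p)] nonempty whenever [f p] is. *)
have [->|Kfg] := eqVneq (\prod_p transport R (f p) (g (lift j p))) 0.
  by rewrite !mul0r.
have e0 : (0 < #|[pred j | g j == empty m.+1 h]|)%N by apply/card_gt0P; exists j.
rewrite ler_wpM2l ?prodr_ge0//; first by move=> p _; exact: transport_ge0.
rewrite lef_pV2 ?posrE ?ltr0n// ler_nat /a.
case: ifPn => [_|].
  by rewrite (leq_trans (max_card _))// card_ord.
rewrite sum_nat_eq0 negb_forall => /existsP[p]; rewrite implyTb => fp.
rewrite -ltnS -[X in (_ < X)%N]card_ord; apply: proper_card; apply/properP.
split; first by apply/fintype.subsetP.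
exists (lift j p) => //; rewrite inE -nvertices_eq0.
have /(transportP R 0)[_ -> _]// : transport R (f p) (g (lift j p)) != 0.
by move/prodf_neq0: Kfg; exact.
Qed.

Lemma transport_row_ge (R : realFieldType) (m h : nat) (t : tree m h) : (0 < m)%N ->
  1 + (nvertices t).-1%:R / (m ^ 2)%:R <= \sum_(u : tree m.+1 h) transport R t u.
Proof.
move=> m0; elim: h t => [|h IH] t.
  by rewrite (bigD1 (tt : tree m.+1 0))//= big1 ?addr0 ?mul0r ?addr0// => -[].
case: t => [[c f]|]; last first.
  rewrite sum_tree/= mul0r addr0 lerDl sumr_ge0// => c _.
  by rewrite big1.
rewrite sum_transport_row; apply: le_trans (sum_branching_ge R m h f m0).
pose q : R := (m ^ 2)%:R.
have q0 : 0 < q by rewrite ltr0n expn_gt0 m0.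
have mq : q = m%:R * m%:R by rewrite /q natrX expr2.
have m0R : 0 < m%:R :> R by rewrite ltr0n.
pose x p : R := (nvertices (f p)).-1%:R / q.
have x0 p : 0 <= x p by rewrite divr_ge0// ltW.
have rowx : 1 + \sum_p x p <= \prod_p \sum_u transport R (f p) u.
  apply: le_trans (prodr_ge_1Dsum R _ x x0) _.
  by apply: ler_prod => p _; rewrite addr_ge0//= IH.
have sx0 : 0 <= \sum_p x p by exact: sumr_ge0.
(* The predecessor in the induction hypothesis loses at most [1/m^2] per child, hence [1/m] over the
   [m] positions: exactly what the root factor [1 + 1/m] repays. *)
have Nx : (\sum_p nvertices (f p))%N%:R / q <= \sum_p x p + m%:R^-1.
  have -> : m%:R^-1 = \sum_(p < m) q^-1 :> R.
    by rewrite sumr_const card_ord -mulr_natl mq; field; rewrite gt_eqF.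
  rewrite natr_sum mulr_suml -big_split; apply: ler_sum => p _ /=.
  rewrite /x -[X in _ + X]mul1r -mulrDl ler_wpM2r ?invr_ge0 ?(ltW q0)//.
  by rewrite natr1 ler_nat leqSpred.
rewrite /=; case: ifPn => [/eqP ->|_].
  by rewrite mul0r divff ?pnatr_eq0// mul1r; lra.
apply: le_trans (ler_wpM2l _ rowx); last by rewrite divr_ge0.
have -> : m.+1%:R / m%:R = 1 + m%:R^-1 :> R.
  by rewrite -natr1; field; rewrite gt_eqF.
have im : 0 <= m%:R^-1 :> R by rewrite invr_ge0 ltW.
nra.
Qed.

(** * Comparison of the counts and divergence of the ratios *)

Lemma card_PnGAS_ge (R : realFieldType) (k d n : nat) :
  #|PnGA k d n|%:R * (1 + n.-1%:R / (k.+1 ^ 2)%:R) <= #|PnGA k.+1 d n|%:R :> R.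
Proof.
rewrite -!sum1_card !natr_sum mulr_suml.
apply: (@le_trans _ _ (\sum_(t in PnGA k d n) \sum_(u in PnGA k.+1 d n) transport R t u)).
  apply: ler_sum => t; rewrite inE => /andP[/eqP nt at_]; rewrite mul1r.
  rewrite -{1}nt; apply: le_trans (transport_row_ge R _ _ t _) _ => //.
  (* By [transportP], any [u] outside [PnGA k.+1 d n] has weight zero, so restricting the row sum
     loses nothing. *)
  rewrite [leRHS]big_mkcond/=; apply: ler_sum => u _; case: ifPn => // uP.
  rewrite le_eqVlt; apply/orP; left; apply: contraR uP => Ktu.
  have [_ nu au] := transportP R k _ _ _ _ Ktu.
  by rewrite inE nu nt eqxx au.
rewrite exchange_big; apply: ler_sum => u _.
apply: le_trans (transport_col_le1 R _ _ u).
rewrite [leLHS]big_mkcond/=; apply: ler_sum => t _; case: ifP => // _.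
exact: transport_ge0.
Qed.

Lemma card_PnGA_le (k r d n : nat) : (r <= k)%N -> (#|PnGA r d n| <= #|PnGA k d n|)%N.
Proof.
move=> /subnK <-; elim: (k - r)%N => // i /leq_trans; apply.
rewrite -(ler_nat rat); apply: le_trans (card_PnGAS_ge rat _ d n).
by rewrite ler_peMr// lerDl divr_ge0.
Qed.

(** A chain of green saddle-nodes is admissible for every [k]; it shows that the denominators of the
    ratios are nonzero. *)
Fixpoint green_path (m n : nat) : tree m.+1 n :=
  if n is n'.+1 return tree m.+1 n
  then Some (Green, [ffun p => if p == ord0 then green_path m n' else empty m.+1 n'])
  else tt.

Lemma PnGA_gt0 (k d n : nat) : (0 < #|PnGA k d n|)%N.
Proof.
apply/card_gt0P; exists (green_path k n); rewrite inE.
elim: n => //= n /andP[/eqP nv adm]; apply/andP; split.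
  rewrite (bigD1 ord0)//= ffunE eqxx nv big1 ?addn0// => p /negPf p0.
  by apply/eqP; rewrite ffunE p0 nvertices_eq0.
apply/andP; split; last first.
  by apply/forallP => p; rewrite ffunE; case: ifP => // _; case: (n).
have -> : child_colors (h := n) [ffun p => if p == ord0 then green_path k n else empty k.+1 n]
    = if n is 0 then [::] else [:: Green].
  rewrite /child_colors enum_ordSl /= ffunE eqxx.
  have -> : forall s : seq 'I_k, pmap (fun p : 'I_k.+1 => root_color
      ([ffun p => if p == ord0 then green_path k n else empty k.+1 n] p)) [seq lift ord0 i | i <- s] = [::].
    by elim=> //= p s ->; rewrite ffunE /=; case: (n).
  by case: (n).
by case: (n).
Qed.

(** By monotonicity in [k] the ratio is at least that of [r.+1] to [r], which grows at least
    linearly in [n]. *)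
Lemma PnGA_ratio_cvgy (R : realType) (d k r : nat) :
  (r < k)%N -> PnGA_ratio R d k r @ \oo --> +oo.
Proof.
move=> rk; apply/cvgryPge => A.
pose q : R := (r.+1 ^ 2)%:R.
have q0 : 0 < q by rewrite ltr0n expn_gt0.
near=> n.
rewrite /PnGA_ratio ler_pdivlMr ?ltr0n ?PnGA_gt0//.
apply: (@le_trans _ _ #|PnGA r.+1 d n|%:R); last by rewrite ler_nat card_PnGA_le.
apply: le_trans (card_PnGAS_ge R r d n); rewrite mulrC ler_wpM2l//.
rewrite -/q -lerBlDl ler_pdivlMr//.
(* The threshold solves [A <= 1 + (n - 1) / q] for [n]. *)
near: n; case: (nbhs_infty_ger ((A - 1) * q + 1)) => N _ HN.
exists N => // n /= Nn; have := HN n Nn; rewrite /= => An.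
have : n%:R <= n.-1%:R + 1 :> R by rewrite natr1 ler_nat; lia.
lra.
Unshelve. all: by end_near. Qed.

Theorem theorem3p3 (R : realType) (k d : nat) (hk : (1 < k)%N) (hd : (4 <= d)%N) :
  [/\ PnGA_ratio R d k.+1 k @ \oo --> +oo,
      PnGA_ratio R d k.+1 2 @ \oo --> +oo
    & PnGA_ratio R d k 1 @ \oo --> +oo].
Proof. by split; apply: PnGA_ratio_cvgy. Qed.
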